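(* The product of two compact Kempisty spaces is a Kempisty space.
   Context: A topological space is Baire if every countable intersection of dense open subsets is dense. A mapping $g:X\to Z$ between topological spaces is quasi-continuous if for every $x_0\in X$, every neighborhood $U$ of $x_0$ and every neighborhood $V$ of $g(x_0)$ there is a nonempty open in $X$ set $G\subseteq U$ with $g(G)\subseteq V$. A function $f:X\times Y\to\mathbb R$ is quasi-continuous in the first variable if $x\mapsto f(x,y)$ is quasi-continuous for each $y\in Y$, and continuous in the second variable if $y\mapsto f(x,y)$ is continuous for each $x\in X$. A mapping $f:X\times Y\to Z$ has the Namioka property if there exists a dense in $X$ $G_\delta$-set $A\subseteq X$ such that $f$ is jointly continuous at each point of $A\times Y$. A topological space $Y$ is a Kempisty space if for every Baire space $X$ every function $f:X\times Y\to\mathbb R$ which is quasi-continuous in the first variable and continuous in the second variable has the Namioka property. Products carry the product topology. *)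

(* Defs.v *)
From HB Require Import structures.
From mathcomp Require Import all_boot all_order all_algebra.
From mathcomp Require Import all_classical all_reals.
From mathcomp Require Import topology normedtype borel_hierarchy.
Import numFieldNormedType.Exports.

Set Implicit Arguments.
Unset Strict Implicit.
Unset Printing Implicit Defensive.

Local Open Scope classical_set_scope.

Definition baire_space (X : topologicalType) : Prop :=
  forall F : nat -> set X,
    (forall n, open (F n) /\ dense (F n)) -> dense (\bigcap_n F n).

Definition quasi_continuous (X Z : topologicalType) (g : X -> Z) : Prop :=
  forall (x0 : X) (U : set X) (V : set Z), nbhs x0 U -> nbhs (g x0) V ->
    exists G : set X, [/\ open G, G !=set0, G `<=` U & g @` G `<=` V].

Definition quasi_continuous_fst (R : realType) (X Y : topologicalType)
    (f : X * Y -> R) : Prop :=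
  forall y : Y, quasi_continuous (fun x => f (x, y)).

Definition continuous_snd (R : realType) (X Y : topologicalType)
    (f : X * Y -> R) : Prop :=
  forall x : X, continuous (fun y => f (x, y)).

Definition namioka_property (X Y Z : topologicalType) (f : X * Y -> Z) : Prop :=
  exists A : set X, [/\ dense A, Gdelta A &
    forall p : X * Y, (A `*` [set: Y]) p -> {for p, continuous f}].

Definition kempisty_space (R : realType) (Y : topologicalType) : Prop :=
  forall X : topologicalType, baire_space X ->
  forall f : X * Y -> R,
    quasi_continuous_fst f -> continuous_snd f -> namioka_property f.

(* Main.v *)
Require Import Defs.
From mathcomp Require Import all_boot all_order all_algebra.
From mathcomp Require Import all_classical all_reals.
From mathcomp Require Import topology normedtype borel_hierarchy.
From mathcomp Require Import lra.
Import numFieldNormedType.Exports.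
Import Order.TTheory GRing.Theory Num.Theory.
Local Open Scope classical_set_scope.
Local Open Scope ring_scope.

Set Implicit Arguments.
Unset Strict Implicit.

(** For [X] Baire and [Y] compact, the Namioka property of a function [f] that
is continuous in [y] says that every nonempty open set of [X] contains, for each
[e > 0], a nonempty open set on which all the functions [f (., y)] oscillate by
at most [e] simultaneously ([namioka_osc], [osc_namioka]).  So let
[f : X * (Y1 * Y2) -> R] be quasi-continuous in [x] and continuous in [(y, z)];
such a uniformly small oscillation has to be found inside a given open [U].  By
hypothesis it is available when one of [y], [z] is frozen, hence also when it
runs through a finite set ([open_shrink_seq]).  The point is to reduce to
finitely many frozen coordinates.

Fix [d > 0] and call [y], [y'] close at [x] if [f (x, (y, z))] and
[f (x, (y', z))] differ by at most [d] for all [z].  For a single [x], compactness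
bounds the number of points of [Y1] that are pairwise not close at [x]
([pairwise_separated_bound]); since [X] is Baire, one bound holds for a dense set
of [x] in some open subset of [U].  A family of points that are pairwise not
close throughout an open set, and that cannot be extended on any smaller open
set, therefore exists ([locally_maximal_pairwise]).  It consists of finitely many
[y_i] such that each [y] is close to one of them for a dense set [D y] of [x].

Freeze the [y_i]: on a smaller open set the functions [f (., (y_i, .))] are, up
to [d], fixed continuous functions of [z].  By compactness of [Y2] there are
finitely many [z_k] such that every [z] has a [z_k] that these functions do not
distinguish from [z], up to [d].  Freeze the [z_k] too.  For [x] in [D y] the
value [f (x, (y, z))] is then within [5 * d] of [f (x, (y, z_k))], which is
constant up to [d], so [f (., (y, z))] oscillates by at most [11 * d] on [D y].
Quasi-continuity carries this bound from the dense set [D y] to the whole open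
set ([quasi_continuous_osc_dense]).

The detour through [D y] is needed because the slice [f (., (y, .))] need not be
quasi-continuous as a map into the sup-normed space of functions of [z]: the
quasi-continuity of [f (., (y, z))] may call for different open sets for
different [z]. *)

(** A finite subcover for neighborhoods that need not be open. *)
Lemma compact_finite_net (Y : topologicalType) (V : Y -> set Y) :
  compact [set: Y] -> (forall y, nbhs y (V y)) ->
  exists s : seq Y, forall y', exists2 y, y \in s & V y y'.
Proof.
move=> /compact_near_coveringP cptY nbhsV.
(* Finite lists ordered by inclusion: a property holds eventually along [F] if it
   holds for all lists containing a certain one. *)
pose F : set_system (seq Y) :=
  [set A | exists s : seq Y, forall t : seq Y, {subset s <= t} -> A t].
have filterF : Filter F.
  split=> [|A B [s As] [t Bt]|A B AB [s As]].
  - by exists [::].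
  - exists (s ++ t) => u stu; split.
      by apply: As => y ys; apply: stu; rewrite mem_cat ys.
    by apply: Bt => y yt; apply: stu; rewrite mem_cat yt orbT.
  - by exists s => t /As /AB.
have [y _|s coverF] :=
    cptY _ F (fun s y' => exists2 y, y \in s & V y y') filterF.
  exists (V y, [set s | y \in s]); last by move=> [y' s] [/= Vy' ys]; exists y.
  split; first exact: nbhsV.
  by exists [:: y] => t sub; apply: sub; rewrite inE.
by exists s => y'; apply: (coverF s (fun _ => id) y').
Qed.

(** Joint continuity along the compact fiber over [x] makes the slices of [f]
uniformly continuous at [x]; this is the tube lemma. *)
Lemma tube_near (R : realType) (X Y : topologicalType) (f : X * Y -> R)
    (x : X) (e : R) :
  compact [set: Y] -> (forall y, {for (x, y), continuous f}) -> 0 < e ->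
  \forall x' \near x, forall y, `|f (x, y) - f (x', y)| <= e.
Proof.
move=> /compact_near_coveringP cptY cf e0.
have e20 : 0 < e / 2 by rewrite divr_gt0.
suff : \forall x' \near x,
    [set: Y] `<=` (fun y => `|f (x, y) - f (x', y)| <= e).
  by apply: filterS => x' close y; exact: close.
apply: cptY => y _.
have /cvgrPdist_le /(_ _ e20) [[A B] /= [nA nB] AB] := cf y.
exists (B, A) => // -[y' x'] [/= By' Ax'].
have := AB (x, y') (conj (nbhs_singleton nA) By').
have := AB (x', y') (conj Ax' By'); rewrite /= !ler_norml.
move=> /andP[? ?] /andP[? ?].
by apply/andP; split; lra.
Qed.

Definition osc_le {R : realType} {X Y : topologicalType} (f : X * Y -> R)
    (e : R) (U : set X) :=
  forall x x' y, U x -> U x' -> `|f (x, y) - f (x', y)| <= e.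

Lemma osc_le_sub (R : realType) (X Y : topologicalType) (f : X * Y -> R)
    (e : R) (U V : set X) : V `<=` U -> osc_le f e U -> osc_le f e V.
Proof. by move=> VU oscU x x' y /VU Ux /VU; apply: oscU. Qed.

(** At a point [x] of a dense set of joint continuity, [tube_near] yields a whole
neighborhood of [x] with small oscillation. *)
Lemma namioka_osc (R : realType) (X Y : topologicalType) (f : X * Y -> R)
    (e : R) (U : set X) :
  compact [set: Y] -> namioka_property f -> 0 < e -> open U -> U !=set0 ->
  exists V, [/\ open V, V !=set0, V `<=` U & osc_le f e V].
Proof.
move=> cptY [A [denseA _ contA]] e0 oU U0.
have [x [Ux Ax]] := denseA U U0 oU.
have e20 : 0 < e / 2 by rewrite divr_gt0.
pose W := [set x' | forall y, `|f (x, y) - f (x', y)| <= e / 2].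
have nW : nbhs x W by apply: tube_near => // y; apply: contA.
exists (U `&` W^°); split.
- by apply: openI => //; exact: open_interior.
- by exists x; split.
- by move=> ? [].
- move=> x1 x2 y [_ /interior_subset W1] [_ /interior_subset W2].
  have := W1 y; have := W2 y; rewrite !ler_norml => /andP[? ?] /andP[? ?].
  by apply/andP; split; lra.
Qed.

(** The union of the open sets of oscillation at most [1 / (n + 1)] is open and
dense.  At a point of all these unions, the uniform control in [x] and the
continuity in [y] give joint continuity. *)
Lemma osc_namioka (R : realType) (X Y : topologicalType) (f : X * Y -> R) :
  baire_space X -> continuous_snd f ->
  (forall (e : R) (U : set X), 0 < e -> open U -> U !=set0 ->
    exists V, [/\ open V, V !=set0, V `<=` U & osc_le f e V]) ->
  namioka_property f.
Proof.
move=> baireX cf small.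
pose O n := \bigcup_(U in [set U : set X | open U /\ osc_le f n.+1%:R^-1 U]) U.
have oO n : open (O n) by apply: bigcup_open => U [].
exists (\bigcap_n O n); split.
- apply: baireX => n; split=> // U U0 oU.
  have [|V [oV [x Vx] VU oscV]] := small n.+1%:R^-1 U _ oU U0.
    by rewrite invr_gt0 ltr0n.
  by exists x; split; [exact: VU | exists V].
- by exists O.
- move=> [x y] [/= Ox _]; apply/cvgrPdist_le => /= e e0.
  have e20 : 0 < e / 2 by rewrite divr_gt0.
  have [n nlt] : exists n, n.+1%:R^-1 <= e / 2.
    by have [n] := ltr_add_invr e20; rewrite add0r => /ltW; exists n.
  have [U [oU oscU] Ux] := Ox n I.
  have /cvgrPdist_le /(_ _ e20) ny := cf x y.
  exists (U, [set y' | `|f (x, y) - f (x, y')| <= e / 2]).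
    by split=> //; exact: open_nbhs_nbhs.
  move=> [x' y'] [/= Ux' /= d1].
  have := le_trans (oscU x x' y' Ux Ux') nlt; move: d1.
  rewrite !ler_norml => /andP[? ?] /andP[? ?].
  by apply/andP; split; lra.
Qed.

(** Shrink once for each property; heredity preserves those already achieved. *)
Lemma open_shrink_seq (X : topologicalType) (I : eqType)
    (P : I -> set X -> Prop) (s : seq I) (U : set X) :
  (forall i U V, V `<=` U -> P i U -> P i V) ->
  (forall i U, open U -> U !=set0 ->
    exists V, [/\ open V, V !=set0, V `<=` U & P i V]) ->
  open U -> U !=set0 ->
  exists V, [/\ open V, V !=set0, V `<=` U & forall i, i \in s -> P i V].
Proof.
move=> hered densP oU U0; elim: s => [|i s [V [oV V0 VU PV]]].
  by exists U; split.
have [W [oW W0 WV PW]] := densP i V oV V0.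
exists W; split=> //; first exact: subset_trans VU.
by move=> j; rewrite inE => /predU1P[->//|/PV]; exact: hered.
Qed.

(** A nonempty open subset of a Baire space is not covered by countably many
nowhere dense sets; a set that is not nowhere dense is dense in some open set. *)
Lemma baire_category (X : topologicalType) (C : nat -> set X) (U : set X) :
  baire_space X -> (forall x, exists k, C k x) -> open U -> U !=set0 ->
  exists k V, [/\ open V, V !=set0, V `<=` U &
    forall W, open W -> W !=set0 -> W `<=` V -> W `&` C k !=set0].
Proof.
move=> baireX coverC oU U0; apply: contrapT => none.
have densF n : open (~` closure (U `&` C n)) /\ dense (~` closure (U `&` C n)).
  split; first by rewrite openC; exact: closed_closure.
  move=> W W0 oW; apply: contrapT => noW; apply: none.
  have Wcl x : W x -> closure (U `&` C n) x.
    by move=> Wx; apply: contrapT => nx; apply: noW; exists x.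
  exists n, (U `&` W); split.
  - exact: openI.
  - have [x Wx] := W0.
    have [z [[Uz _] Wz]] := Wcl x Wx W (open_nbhs_nbhs (conj oW Wx)).
    by exists z.
  - by move=> ? [].
  - move=> G oG [x Gx] GW; have [_ Wx] := GW x Gx.
    have [z [[_ Cz] Gz]] := Wcl x Wx G (open_nbhs_nbhs (conj oG Gx)).
    by exists z.
have [x [Ux Fx]] := baireX _ densF U U0 oU.
have [k Ck] := coverC x.
by apply: (Fx k I); apply: subset_closure.
Qed.

(** If the family could always be prolonged after shrinking the open set, lists of
every length would be pairwise related at all points of some open set.  This is
absurd inside an open set where the points having a fixed bound [k] are dense. *)
Lemma locally_maximal_pairwise (X : topologicalType) (T : eqType)
    (r : X -> rel T) (U : set X) :
  baire_space X ->
  (forall x, exists k, forall s, pairwise (r x) s -> (size s <= k)%N) ->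
  open U -> U !=set0 ->
  exists V s, [/\ open V, V !=set0, V `<=` U &
    forall t W, open W -> W !=set0 -> W `<=` V ->
      exists2 x, W x & has (fun t' => ~~ r x t t') s].
Proof.
move=> baireX bound oU U0.
have [k [V [oV V0 VU densV]]] := @baire_category X
  (fun k => [set x | forall s, pairwise (r x) s -> (size s <= k)%N])
  U baireX bound oU U0.
apply: contrapT => none.
have long n : exists W s, [/\ open W, W !=set0, W `<=` V, size s = n &
    forall x, W x -> pairwise (r x) s].
  elim: n => [|n [W [s [oW W0 WV sn prs]]]].
    by exists V, [::]; split.
  apply: contrapT => noext; apply: none; exists W, s; split=> //.
    exact: subset_trans VU.
  move=> t G oG G0 GW; apply: contrapT => nox; apply: noext.
  exists G, (t :: s); split=> //=; [exact: subset_trans WV | by rewrite sn|].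
  move=> x Gx; rewrite prs ?andbT; last exact: GW.
  by apply: contrapT => /negP; rewrite -has_predC => hx; apply: nox; exists x.
have [W [s [oW W0 WV sn prs]]] := long k.+1.
have [x [Wx /(_ s (prs x Wx))]] := densV W oW W0 WV.
by rewrite sn ltnn.
Qed.

(** Each value of [h] is approximated by its values on a nonempty open set, which
meets [D]. *)
Lemma quasi_continuous_osc_dense (R : realType) (X : topologicalType)
    (h : X -> R) (U D : set X) (e : R) :
  quasi_continuous h -> open U ->
  (forall W, open W -> W !=set0 -> W `<=` U -> W `&` D !=set0) ->
  (forall x x', U x -> U x' -> D x -> D x' -> `|h x - h x'| <= e) ->
  forall x x', U x -> U x' -> `|h x - h x'| <= e.
Proof.
move=> qch oU densD oscD.
have approx x (d : R) : U x -> 0 < d ->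
    exists x', [/\ U x', D x' & `|h x - h x'| <= d].
  move=> Ux d0.
  have nV : nbhs (h x) [set r | `|h x - r| <= d].
    by apply: (@cvgr_dist_le _ _ _ (nbhs (h x)) _ id (h x)).
  have [G [oG G0 GU hG]] := qch x U _ (open_nbhs_nbhs (conj oU Ux)) nV.
  have [x' [Gx' Dx']] := densD G oG G0 GU.
  by exists x'; split=> //; [exact: GU | by apply: hG; exists x'].
move=> x x' Ux Ux'; apply/ler_addgt0Pr => d d0.
have d20 : 0 < d / 2 by rewrite divr_gt0.
have [a [Ua Da]] := approx x _ Ux d20; have [b [Ub Db]] := approx x' _ Ux' d20.
have := oscD a b Ua Ub Da Db; rewrite !ler_norml.
move=> /andP[? ?] /andP[? ?] /andP[? ?].
by apply/andP; split; lra.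
Qed.

(** Send each point to a nearby point of a finite [d / 2]-net of [Y].  Points with
the same image are [d]-close, so the map is injective on a separated list. *)
Lemma pairwise_separated_bound (R : realType) (Y Z : topologicalType)
    (h : Y * Z -> R) (d : R) :
  compact [set: Y] -> compact [set: Z] -> continuous h -> 0 < d ->
  exists k, forall s,
    pairwise (fun y y' => ~~ `[< forall z, `|h (y, z) - h (y', z)| <= d >]) s ->
    (size s <= k)%N.
Proof.
move=> cptY cptZ ch d0.
have d20 : 0 < d / 2 by rewrite divr_gt0.
have [t net] := compact_finite_net cptY
  (fun y => tube_near cptZ (fun z => ch (y, z)) d20).
have /choice[g gP] : forall y, exists y', y' \in t /\
    forall z, `|h (y', z) - h (y, z)| <= d / 2.
  by move=> y; have [y' ? ?] := net y; exists y'.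
exists (size t) => s prs; rewrite -(size_map g).
apply: uniq_leq_size; last by move=> _ /mapP[y _ ->]; exact: (gP y).1.
rewrite uniq_pairwise pairwise_map; apply: sub_pairwise prs.
move=> y y' /asboolPn sep.
apply/eqP => gyy'; apply: sep => z.
have := (gP y).2 z; have := (gP y').2 z; rewrite -gyy' !ler_norml.
move=> /andP[? ?] /andP[? ?].
by apply/andP; split; lra.
Qed.

Unset Implicit Arguments.
Set Strict Implicit.

Theorem corollary4p5 (R : realType) (Y1 Y2 : topologicalType)
    (compY1 : compact [set: Y1]) (compY2 : compact [set: Y2])
    (kempY1 : kempisty_space R Y1) (kempY2 : kempisty_space R Y2) :
  kempisty_space R (Y1 * Y2)%type.
Proof.
move=> X baireX f qcf cf; apply: osc_namioka => // e U e0 oU U0.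
(* Two estimates by [5 * d] for points of a dense set, and one by [d]. *)
pose d := e / 11; have d0 : 0 < d by rewrite divr_gt0.
have small1 z (V : set X) : open V -> V !=set0 -> exists W,
    [/\ open W, W !=set0, W `<=` V & osc_le (fun p => f (p.1, (p.2, z))) d W].
  move=> oV V0; apply: namioka_osc => //; apply: kempY1 => //.
    by move=> y; exact: (qcf (y, z)).
  move=> x y; apply: (continuous_comp (f := pair^~ z)
      (g := fun q => f (x, q))); last exact: cf.
  by apply: cvg_pair => //=; exact: cvg_cst.
have small2 y (V : set X) : open V -> V !=set0 -> exists W,
    [/\ open W, W !=set0, W `<=` V & osc_le (fun p => f (p.1, (y, p.2))) d W].
  move=> oV V0; apply: namioka_osc => //; apply: kempY2 => //.
    by move=> z; exact: (qcf (y, z)).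
  move=> x z; apply: (continuous_comp (f := pair y)
      (g := fun q => f (x, q))); last exact: cf.
  by apply: cvg_pair => //=; exact: cvg_cst.
pose close x y y' := `[< forall z, `|f (x, (y, z)) - f (x, (y', z))| <= d >].
have [V [s [oV V0 VU densV]]] := @locally_maximal_pairwise X Y1
  (fun x y y' => ~~ close x y y') U baireX
  (fun x => pairwise_separated_bound compY1 compY2 (cf x) d0) oU U0.
have [W [oW [a Wa] WV oscW]] := open_shrink_seq s
  (fun y => @osc_le_sub _ _ _ _ d) small2 oV V0.
(* The net of [Y2] is taken for the single function [f (a, .)], uniformly in [y]:
   on [W] this function represents all [f (x, (y_i, .))], [y_i] in [s]. *)
have [t net] := compact_finite_net compY2 (fun z =>
  @tube_near R Y2 Y1 (fun q => f (a, (q.2, q.1))) z d compY1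
   (fun y => (@continuous_comp _ _ _ (fun q : Y2 * Y1 => (q.2, q.1))
     (fun q => f (a, q)) (z, y) (@swap_continuous _ _ _) (cf a _))) d0).
have [G [oG G0 GW oscG]] := open_shrink_seq t
  (fun z => @osc_le_sub _ _ _ _ d) small1 oW (ex_intro _ a Wa).
exists G; split=> //; first by apply: subset_trans VU; exact: subset_trans WV.
move=> x x' [y z]; have [zk zkt zkz] := net z.
pose D := [set x | has (close x y) s].
apply: (@quasi_continuous_osc_dense _ _ (fun x => f (x, (y, z))) _ D) => //.
  move=> H oH H0 HG; have [b Hb] := densV y H oH H0
    (subset_trans HG (subset_trans GW WV)).
  under eq_has do rewrite negbK.
  by exists b.
have est b : G b -> D b -> `|f (b, (y, z)) - f (b, (y, zk))| <= d *+ 5.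
  move=> Gb /hasP[y' ys /asboolP cl].
  (* The intermediate values are those at [(b, (y', z))], [(a, (y', z))],
     [(a, (y', zk))] and [(b, (y', zk))]. *)
  have := cl z; have := cl zk; have := zkz y'.
  have := oscW y' ys b a z (GW _ Gb) Wa.
  have := oscW y' ys b a zk (GW _ Gb) Wa => /=; rewrite !ler_norml.
  move=> /andP[? ?] /andP[? ?] /andP[? ?] /andP[? ?] /andP[? ?].
  by apply/andP; split; lra.
move=> b c Gb Gc Db Dc.
have := est b Gb Db; have := est c Gc Dc.
have := oscG zk zkt b c y Gb Gc => /=; rewrite /d !ler_norml.
move=> /andP[? ?] /andP[? ?] /andP[? ?].
by apply/andP; split; lra.
Qed.
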